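(* Let $I$ be a right ideal of $\mathbb{H}[q_1,\ldots,q_n]$. Then the symmetrization of $\mathcal{V}_c(I)$ is a slice algebraic set; more precisely $$\mathbb{S}_{\mathcal{V}_c(I)}=\mathcal{V}_c(\mathcal{S}(I)).$$
   Context: $\mathbb{H}$ is the skew field of quaternions, $\mathbb{S}=\{J\in\mathbb{H}: J^2=-1\}$, and for $K\in\mathbb{S}$, $\mathbb{C}_K=\mathbb{R}+\mathbb{R}K\cong\mathbb{C}$. $\mathbb{H}[q_1,\ldots,q_n]$ is the set of slice regular polynomials, i.e. functions $P:\mathbb{H}^n\to\mathbb{H}$, $P(q_1,\ldots,q_n)=\sum q_1^{\ell_1}\cdots q_n^{\ell_n}a_{\ell_1,\ldots,\ell_n}$ (finite sum, variables in this order, coefficients in $\mathbb{H}$ on the right). It is a ring under pointwise sum and the $*$-product determined by $(q^{\ell}a)*(q^{m}b)=q^{\ell+m}ab$ for multi-indices $\ell,m$, where $q^\ell=q_1^{\ell_1}\cdots q_n^{\ell_n}$. For a right ideal $I$, $\mathcal{V}(I)\subseteq\mathbb{H}^n$ is the set of common zeros of all $P\in I$, and $\mathcal{V}_c(I)=\mathcal{V}(I)\cap\bigcup_{K\in\mathbb{S}}\mathbb{C}_K^n$. The regular conjugate $P^c$ of $P$ is obtained by conjugating all coefficients: $P^c=\sum q^\ell\,\overline{a_\ell}$; the symmetrization of $P$ is $P^s=P*P^c=P^c*P$. The symmetrized ideal is $\mathcal{S}(I)=\langle P^s: P\in I\rangle$, the right ideal generated by the $P^s$. For $\mathbf{a}=(a_1,\ldots,a_n)\in\mathbb{H}^n$,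 $\mathbb{S}_{\mathbf{a}}=\{(g^{-1}a_1g,\ldots,g^{-1}a_ng): g\in\mathbb{H}\setminus\{0\}\}$. For a set $Z_c\subseteq\mathbb{H}^n$ of points with commuting components, its symmetrization is $\mathbb{S}_{Z_c}=\bigcup_{\mathbf{a}\in Z_c}\mathbb{S}_{\mathbf{a}}$. A subset $V\subseteq\mathbb{H}^n$ is slice algebraic if for every $K\in\mathbb{S}$, $V\cap\mathbb{C}_K^n$ is a complex algebraic subset of $\mathbb{C}_K^n$. *)

(* Defs.v *)
From HB Require Import structures.
From mathcomp Require Import all_boot all_order all_algebra.
From mathcomp Require Import complex ssrcomplements mpoly ring lra.
From mathcomp Require Import boolp classical_sets reals.

Set Implicit Arguments.
Unset Strict Implicit.
Unset Printing Implicit Defensive.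

Import Order.TTheory GRing.Theory Num.Theory.

Local Open Scope classical_set_scope.
Local Open Scope ring_scope.

(* [Quat a b c d] is a + b i + c j + d k. *)
Record quat (R : Type) := Quat { q_re : R; q_i : R; q_j : R; q_k : R }.

Definition quat_encode (R : Type) (x : quat R) : R * R * R * R :=
  (q_re x, q_i x, q_j x, q_k x).

Definition quat_decode (R : Type) (t : R * R * R * R) : quat R :=
  let: (a, b, c, d) := t in Quat a b c d.

Lemma quat_encodeK (R : Type) : cancel (@quat_encode R) (@quat_decode R).
Proof. by case. Qed.

HB.instance Definition _ (R : choiceType) :=
  Choice.copy (quat R) (can_type (@quat_encodeK R)).

Section QuatRing.
Variable R : realFieldType.
Implicit Types x y z : quat R.

Definition quat0 : quat R := Quat 0 0 0 0.
Definition quat1 : quat R := Quat 1 0 0 0.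

Definition quat_opp x := Quat (- q_re x) (- q_i x) (- q_j x) (- q_k x).

Definition quat_add x y :=
  Quat (q_re x + q_re y) (q_i x + q_i y) (q_j x + q_j y) (q_k x + q_k y).

Definition quat_mul x y := Quat
  (q_re x * q_re y - q_i x * q_i y - q_j x * q_j y - q_k x * q_k y)
  (q_re x * q_i y + q_i x * q_re y + q_j x * q_k y - q_k x * q_j y)
  (q_re x * q_j y - q_i x * q_k y + q_j x * q_re y + q_k x * q_i y)
  (q_re x * q_k y + q_i x * q_j y - q_j x * q_i y + q_k x * q_re y).

Definition quat_conj x := Quat (q_re x) (- q_i x) (- q_j x) (- q_k x).

Definition quat_normsq x : R :=
  q_re x ^+ 2 + q_i x ^+ 2 + q_j x ^+ 2 + q_k x ^+ 2.

Definition quat_inv x :=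
  let N := quat_normsq x in
  Quat (q_re x / N) (- q_i x / N) (- q_j x / N) (- q_k x / N).

Lemma quat_addA : associative quat_add.
Proof. by move=> [a b c d] [e f g h] [k l m n]; congr Quat; rewrite /= addrA. Qed.

Lemma quat_addC : commutative quat_add.
Proof. by move=> [a b c d] [e f g h]; congr Quat; rewrite /= addrC. Qed.

Lemma quat_add0 : left_id quat0 quat_add.
Proof. by move=> [a b c d]; congr Quat; rewrite /= add0r. Qed.

Lemma quat_addN : left_inverse quat0 quat_opp quat_add.
Proof. by move=> [a b c d]; congr Quat; rewrite /= addNr. Qed.

HB.instance Definition _ :=
  GRing.isZmodule.Build (quat R) quat_addA quat_addC quat_add0 quat_addN.

Lemma quat_mulA : associative quat_mul.
Proof. by move=> [a b c d] [e f g h] [k l m n]; congr Quat => /=; ring. Qed.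

Lemma quat_mul1l : left_id quat1 quat_mul.
Proof. by move=> [a b c d]; congr Quat => /=; ring. Qed.

Lemma quat_mul1r : right_id quat1 quat_mul.
Proof. by move=> [a b c d]; congr Quat => /=; ring. Qed.

Lemma quat_mulDl : left_distributive quat_mul +%R.
Proof. by move=> [a b c d] [e f g h] [k l m n]; congr Quat => /=; ring. Qed.

Lemma quat_mulDr : right_distributive quat_mul +%R.
Proof. by move=> [a b c d] [e f g h] [k l m n]; congr Quat => /=; ring. Qed.

Lemma quat1_neq0 : quat1 != 0.
Proof. by apply/eqP => -[] /eqP; rewrite oner_eq0. Qed.

HB.instance Definition _ :=
  GRing.Zmodule_isNzRing.Build (quat R)
    quat_mulA quat_mul1l quat_mul1r quat_mulDl quat_mulDr quat1_neq0.

Lemma quat_normsq_eq0 x : (quat_normsq x == 0) = (x == 0).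
Proof.
case: x => a b c d; rewrite /quat_normsq /=; apply/eqP/eqP => [N0|]; last first.
  by case=> -> -> -> ->; rewrite expr0n !addr0.
by congr Quat; apply/eqP; rewrite -sqrf_eq0; apply/eqP;
  have := sqr_ge0 a; have := sqr_ge0 b; have := sqr_ge0 c;
  have := sqr_ge0 d; lra.
Qed.

Lemma quat_mulV : {in [pred x | x != 0], left_inverse 1 quat_inv *%R}.
Proof.
move=> x; rewrite inE -quat_normsq_eq0.
case: x => a b c d; rewrite /quat_normsq /= => N0.
by congr Quat => /=; rewrite /quat_normsq /=; field.
Qed.

Lemma quat_divr : {in [pred x | x != 0], right_inverse 1 quat_inv *%R}.
Proof.
move=> x; rewrite inE -quat_normsq_eq0.
case: x => a b c d; rewrite /quat_normsq /= => N0.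
by congr Quat => /=; rewrite /quat_normsq /=; field.
Qed.

Lemma quat_unitP x y : y * x = 1 /\ x * y = 1 -> [pred x | x != 0] x.
Proof.
move=> [yx _] /=; apply/eqP => x0; move: yx; rewrite x0 mulr0 => /eqP.
by rewrite eq_sym oner_eq0.
Qed.

Lemma quat_inv_out : {in [predC [pred x | x != 0]], quat_inv =1 id}.
Proof.
move=> x; rewrite !inE negbK => /eqP ->.
by congr Quat; rewrite /= ?oppr0 mul0r.
Qed.

HB.instance Definition _ :=
  GRing.NzRing_hasMulInverse.Build (quat R)
    quat_mulV quat_divr quat_unitP quat_inv_out.

End QuatRing.

Section SlicePolynomials.
Variables (R : realType) (n : nat).
Implicit Types (P : {mpoly (quat R)[n]}) (a : 'rV[quat R]_n).

(* [{mpoly (quat R)[n]}] has central variables, so its product is the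
   *-product.  Evaluation puts the coefficients on the right, hence the
   library's [meval], which puts them on the left, cannot be used; the product
   below is taken in the order of the variables. *)
Definition slice_eval P a : quat R :=
  \sum_(m <- msupp P) (\prod_(i < n) a 0 i ^+ m i) * P@_m.

Definition quat_real (t : R) : quat R := Quat t 0 0 0.

Let quat_realX t m : quat_real t ^+ m = quat_real (t ^+ m).
Proof.
elim: m => [|m IH]; first by rewrite !expr0.
by rewrite !exprS IH; congr Quat => /=; ring.
Qed.

Let slice_evalE k P a : (msize P <= k)%N ->
  slice_eval P a =
  \sum_(m : 'X_{1..n < k}) (\prod_(i < n) a 0 i ^+ m i) * P@_m.
Proof.
move=> le; rewrite /slice_eval.
rewrite (big_mksub 'X_{1..n < k}) ?msupp_uniq //=; first last.
  by move=> x /msize_mdeg_lt /leq_trans; apply.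
by rewrite big_rmcond //= => m /memN_msupp_eq0 ->; rewrite mulr0.
Qed.

Let digits_inj k (N : nat) (f g : nat -> nat) :
  (forall i, f i < k)%N -> (forall i, g i < k)%N ->
  (\sum_(i < N) f i * k ^ i = \sum_(i < N) g i * k ^ i)%N ->
  forall i, (i < N)%N -> f i = g i.
Proof.
elim: N f g => // N IH f g fk gk; rewrite !big_ord_recl /= !expn0 !muln1.
have sh (h : nat -> nat) :
    (\sum_(i < N) h (bump 0 i) * k ^ bump 0 i =
     (\sum_(i < N) h i.+1 * k ^ i) * k)%N.
  by rewrite big_distrl; apply: eq_bigr => i _; rewrite /bump /= add1n expnSr mulnA.
rewrite !sh => E; have k0 : (0 < k)%N by exact: leq_ltn_trans (fk 0%N).
have E0 : f 0%N = g 0%N.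
  by have := congr1 (modn^~ k) E; rewrite /= !(addnC _ (_ * k)%N) !modnMDl !modn_small.
move=> [|i] // iN; apply: (IH (f \o S) (g \o S)) => //= .
by move/eqP: E; rewrite E0 eqn_add2l eqn_pmul2r // => /eqP.
Qed.

(* Thus [{mpoly (quat R)[n]}] is in bijection with the slice regular
   polynomial functions on H^n. *)
Lemma slice_eval_inj P Q : (forall a, slice_eval P a = slice_eval Q a) -> P = Q.
Proof.
move=> PQ; pose k := maxn 1 (maxn (msize P) (msize Q)).
have Pk : (msize P <= k)%N by rewrite /k !leq_max leqnn orbT.
have Qk : (msize Q <= k)%N by rewrite /k !leq_max leqnn !orbT.
pose e (m : 'X_{1..n}) := (\sum_(i < n) m i * k ^ i)%N.
pose D m := P@_m - Q@_m.
have DE t : \sum_(m : 'X_{1..n < k}) quat_real (t ^+ e m) * D m = 0.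
  have := PQ (\row_i quat_real (t ^+ (k ^ i))).
  rewrite (slice_evalE _ Pk) (slice_evalE _ Qk) => /eqP.
  rewrite -subr_eq0 -sumrB => /eqP E; rewrite -[RHS]E; apply: eq_bigr => m _.
  rewrite -mulrBr; congr (_ * _); rewrite /e -prodrXr.
  rewrite (big_morph quat_real (op1 := *%R) (id1 := 1)) //; last first.
    by move=> x y; congr Quat => /=; ring.
  by apply: eq_bigr => i _; rewrite mxE quat_realX mulnC exprM.
have e_inj (m m' : 'X_{1..n < k}) : e m = e m' -> m = m'.
  move=> E; apply/val_inj/mnmP => i.
  have lt (m1 : 'X_{1..n < k}) j : ((bmnm m1) j < k)%N.
    by apply: leq_ltn_trans (bmdeg m1); rewrite mdegE (bigD1 j) //= leq_addr.
  pose f (m1 : 'X_{1..n < k}) j := if insub j is Some j' then (bmnm m1) j' else 0%N.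
  have fk m1 j : (f m1 j < k)%N.
    by rewrite /f; case: insubP => // _; rewrite /k leq_max.
  have fE m1 (j : 'I_n) : f m1 j = (bmnm m1) j by rewrite /f valK.
  rewrite -!fE; apply: (@digits_inj k n) => //.
  by under eq_bigr do rewrite fE; under [RHS]eq_bigr do rewrite fE.
have comp0 (c : quat R -> R) :
    c 0 = 0 -> {morph c : x y / x + y} ->
    (forall t x, c (quat_real t * x) = t * c x) ->
    forall m : 'X_{1..n < k}, c (D m) = 0.
  move=> c0 cD cM m.
  pose p : {poly R} := \sum_(m : 'X_{1..n < k}) c (D m) *: 'X^(e m).
  have p0 : p = 0.
    apply/eqP; apply: contraT => pn0.
    pose rs : seq R := [seq i%:R | i <- iota 0 (size p)].
    have := max_poly_roots pn0 (rs := rs).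
    rewrite size_map size_iota ltnn; apply.
      apply/allP => t _; apply/rootP; rewrite horner_sum.
      rewrite -[RHS]c0 -(DE t) (big_morph c cD c0); apply: eq_bigr => m' _.
      by rewrite hornerZ hornerXn cM mulrC.
    rewrite map_inj_uniq ?iota_uniq // => x y /eqP.
    by rewrite eqr_nat => /eqP.
  have := congr1 (fun q : {poly R} => q`_(e m)) p0.
  rewrite coef0 coef_sum (bigD1 m) //= big1 => [|m' nm].
    by rewrite addr0 coefZ coefXn eqxx mulr1.
  rewrite coefZ coefXn; case: eqP => [/e_inj E|]; last by rewrite mulr0.
  by rewrite E eqxx in nm.
have D0 (m : 'X_{1..n < k}) : D m = 0.
  have cr := comp0 (@q_re R); have ci := comp0 (@q_i R).
  have cj := comp0 (@q_j R); have ck := comp0 (@q_k R).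
  have Q0 : forall x : quat R, q_re x = 0 -> q_i x = 0 -> q_j x = 0 ->
     q_k x = 0 -> x = 0 by move=> [a b c d] /= -> -> -> ->.
  by apply: Q0; [apply: cr|apply: ci|apply: cj|apply: ck] => // t x /=; ring.
apply/mpolyP => m; case: (ltnP (mdeg m) k) => mk.
  by apply/eqP; rewrite -subr_eq0; apply/eqP; exact: (D0 (BMultinom mk)).
by rewrite !memN_msupp_eq0 //; apply: contraL mk => /msize_mdeg_lt h;
  rewrite -ltnNge (leq_trans h).
Qed.

Definition reg_conj P : {mpoly (quat R)[n]} := map_mpoly (@quat_conj R) P.

Definition reg_sym P : {mpoly (quat R)[n]} := P * reg_conj P.

Record right_ideal (I : set {mpoly (quat R)[n]}) : Prop := RightIdeal {
  right_ideal0 : I 0;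
  right_idealD : forall P Q, I P -> I Q -> I (P + Q);
  right_idealM : forall P Q, I P -> I (P * Q) }.

Definition right_ideal_gen (A : set {mpoly (quat R)[n]}) :
    set {mpoly (quat R)[n]} :=
  [set P | forall J, right_ideal J -> A `<=` J -> J P].

Definition sym_ideal (I : set {mpoly (quat R)[n]}) :=
  right_ideal_gen (reg_sym @` I).

Definition imag_unit : set (quat R) := [set J | J ^+ 2 = -1].

Definition to_slice (K : quat R) (z : R[i]) : quat R :=
  quat_real (complex.Re z) + quat_real (complex.Im z) * K.

Definition slice_space (K : quat R) : set 'rV[quat R]_n :=
  range (map_mx (to_slice K)).

Definition zero_set (I : set {mpoly (quat R)[n]}) : set 'rV[quat R]_n :=
  [set a : 'rV[quat R]_n | forall P, I P -> slice_eval P a = 0].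

Definition zero_set_c (I : set {mpoly (quat R)[n]}) : set 'rV[quat R]_n :=
  zero_set I `&` \bigcup_(K in imag_unit) slice_space K.

Definition conj_orbit a : set 'rV[quat R]_n :=
  [set map_mx (fun x => g^-1 * x * g) a | g in [set g | g != 0]].

Definition symmetrization (Z : set 'rV[quat R]_n) : set 'rV[quat R]_n :=
  \bigcup_(a in Z) conj_orbit a.

Definition complex_zeros (F : set {mpoly R[i][n]}) : set 'rV[R[i]]_n :=
  [set z : 'rV[R[i]]_n | forall f, F f -> f.@[z 0] = 0].

Definition slice_algebraic (V : set 'rV[quat R]_n) : Prop :=
  forall K, imag_unit K -> exists F : set {mpoly R[i][n]},
    V `&` slice_space K = map_mx (to_slice K) @` complex_zeros F.

End SlicePolynomials.

(* Main.v *)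
Require Import Defs.
From HB Require Import structures.
From mathcomp Require Import all_boot all_order all_algebra.
From mathcomp Require Import complex ssrcomplements mpoly ring lra.
From mathcomp Require Import boolp classical_sets reals.

(** For a point [a] with commuting components and a polynomial [P], consider the
    twisted evaluation [g |-> \sum_l a^l * g * P_l], written [twisted_eval P a].
    It holds all the values of [P] on the conjugation orbit of [a], because
    [P (g^-1 a g) = g^-1 * twisted_eval P a g], and it turns the star product
    into composition: [twisted_eval (P * Q) a] is [twisted_eval Q a] after
    [twisted_eval P a].  If [a] lies in the slice of an imaginary unit [K], it is
    moreover linear for left multiplication by the centralizer of [K], which is
    the field [C_K], and the quaternions are a plane over this field.

    The coefficients of [P^s] are real, hence central; so the zeros of [P^s] are
    stable under conjugation and [twisted_eval P^s a g = P^s(a) * g].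

    If all of [I] vanishes at [a], then every [P^s] with [P] in [I] vanishes at
    [a], hence on its orbit, and so does the right ideal that they generate.
    This is the easy inclusion.

    Conversely, suppose that all [P^s] vanish at [b].  Each map
    [twisted_eval P b] is then singular ([sym_zero_singular]): after
    [twisted_eval P^c b] it gives 0, and it kills 1 if
    [twisted_eval P^c b] is itself zero.  The point is to find one [g] in the
    kernel of all these maps at once, for [g^-1 b g] is then a common zero of [I]
    ([singular_common_kernel]).  Suppose that [P] in [I] has a nonzero map which
    kills [g], and that some [P'] in [I] has a map that does not.  The map of
    [P * c + P'] has the same nonzero value at [g] as the map of [P'], and on a
    second basis vector any value at all, for a suitable constant [c]; a good
    choice of it makes the map bijective, although [P * c + P'] is in [I].

    Finally, [V_c(S(I))] is cut out in the slices by the [P^s] alone.  Having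
    real coefficients, they restrict to complex polynomials on each slice,
    whence slice algebraicity. *)

Set Implicit Arguments.
Unset Strict Implicit.
Unset Printing Implicit Defensive.

Import Order.TTheory GRing.Theory Num.Theory.

Local Open Scope classical_set_scope.
Local Open Scope ring_scope.

(** * Quaternions *)

Section Quaternions.
Variable R : realType.
Implicit Types (x y z g K J : quat R) (t : R).

Lemma quat_unitE x : (x \is a GRing.unit) = (x != 0).
Proof. by []. Qed.

Lemma quat_mul_neq0 x y : x != 0 -> y != 0 -> x * y != 0.
Proof. by move=> x0 y0; rewrite -quat_unitE unitrMl. Qed.

Lemma quat_inv_neq0 x : x != 0 -> x^-1 != 0.
Proof. by rewrite -!quat_unitE unitrV. Qed.

Lemma quat_conj_is_zmod_morphism : zmod_morphism (@quat_conj R).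
Proof. by move=> [a b c d] [e f g h]; congr Quat => /=; ring. Qed.

HB.instance Definition _ :=
  GRing.isZmodMorphism.Build (quat R) (quat R) (@quat_conj R)
    quat_conj_is_zmod_morphism.

Lemma quat_conjM x y : quat_conj (x * y) = quat_conj y * quat_conj x.
Proof. by case: x y => [a b c d] [e f g h]; congr Quat => /=; ring. Qed.

Lemma quat_conjK : involutive (@quat_conj R).
Proof. by case=> a b c d; congr Quat; rewrite /= opprK. Qed.

Lemma quat_conj_real x : quat_conj x = x -> x = quat_real (q_re x).
Proof. by case: x => a b c d [*]; congr Quat => /=; lra. Qed.

Lemma quat_re_is_zmod_morphism : zmod_morphism (@q_re R).
Proof. by move=> [a b c d] [e f g h]. Qed.

HB.instance Definition _ :=
  GRing.isZmodMorphism.Build (quat R) R (@q_re R) quat_re_is_zmod_morphism.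

Lemma quat_reC x y : q_re (x * y) = q_re (y * x).
Proof. by case: x y => [a b c d] [e f g h] /=; ring. Qed.

Lemma quat_realC t x : quat_real t * x = x * quat_real t.
Proof. by case: x => a b c d; congr Quat => /=; ring. Qed.

(** Conjugation is an anti-automorphism, yet it can be undone by left and right
    multiplications, and these are all that twisted evaluations see. *)
Lemma quat_conj_units x :
  let i := Quat 0 1 0 0 in let j := Quat 0 0 1 0 in let k := Quat 0 0 0 1 in
  x = - (quat_real 2^-1 * (quat_conj x + i * quat_conj x * i
                           + j * quat_conj x * j + k * quat_conj x * k)).
Proof. by case: x => a b c d; congr Quat => /=; field. Qed.

(** A vector orthogonal to the imaginary vector [K]. *)
Lemma anticommuting_exists K : K ^+ 2 = -1 ->
  exists2 J, J != 0 & K * J = - (J * K).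
Proof.
case: K => a b c d [Ea Eb Ec Ed].
have a0 : a = 0.
  apply/eqP; apply: contraT => an0.
  have z0 (y : R) : a * y + a * y = 0 -> y = 0.
    by move=> E; apply: (mulfI an0); rewrite mulr0; lra.
  have b0 : b = 0 by apply: z0; rewrite -[RHS]oppr0 -Eb; ring.
  have c0 : c = 0 by apply: z0; rewrite -[RHS]oppr0 -Ec; ring.
  have d0 : d = 0 by apply: z0; rewrite -[RHS]oppr0 -Ed; ring.
  by move: Ea; rewrite b0 c0 d0; have := sqr_ge0 a; rewrite expr2; lra.
rewrite a0; have [[c0 d0]|ncd] := pselect (c = 0 /\ d = 0).
  exists (Quat 0 0 1 0); last by rewrite c0 d0; congr Quat => /=; ring.
  by apply/eqP => -[/eqP]; rewrite oner_eq0.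
exists (Quat 0 0 (- d) c); last by congr Quat => /=; ring.
by apply/eqP => -[d0 c0]; apply: ncd; split=> //; lra.
Qed.

(** [x = (x - K x K) / 2 + (x + K x K) / 2], where the first term commutes and
    the second anticommutes with [K], hence commutes with it once divided
    by [J]. *)
Lemma centralizer_basis K J x : K ^+ 2 = -1 -> J != 0 -> K * J = - (J * K) ->
  exists al be, [/\ GRing.comm al K, GRing.comm be K & x = al + be * J].
Proof.
rewrite expr2 => KK J0 KJ; pose h : quat R := quat_real 2^-1.
have JU : J \is a GRing.unit by [].
have JVK : J^-1 * K = - (K * J^-1).
  apply: (mulrI JU); rewrite mulrA mulrV // mul1r mulrN mulrA.
  by rewrite -[J * K]opprK -KJ mulNr opprK mulrK.
have KKx y : K * (K * y) = - y by rewrite mulrA KK mulN1r.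
have xKK y : y * K * K = - y by rewrite -mulrA KK mulrN1.
have hK y : K * (h * y) = h * (K * y) by rewrite mulrA -quat_realC mulrA.
exists (h * (x - K * x * K)), (h * (x + K * x * K) * J^-1); split.
- rewrite /GRing.comm hK -mulrA; congr (h * _).
  by rewrite mulrBl mulrBr -!mulrA KKx !mulrA xKK !opprK addrC.
- rewrite /GRing.comm -mulrA JVK mulrN !mulrA -mulNr; congr (_ * _).
  rewrite -[K * h * _]mulrA hK -[h * _ * K]mulrA -mulrN; congr (h * _).
  rewrite mulrDl mulrDr -!mulrA KKx !mulrA xKK.
  by rewrite opprB.
rewrite mulrVK // -mulrDr addrA addrAC subrK mulrDr -mulrDl -[LHS]mul1r.
by congr (_ * _); congr Quat => /=; lra.
Qed.

End Quaternions.

(** * Twisted evaluation *)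

Section TwistedEvaluation.
Variables (R : realType) (n : nat).
Implicit Types (P Q : {mpoly (quat R)[n]}) (a b : 'rV[quat R]_n).
Implicit Types (g x K : quat R) (m : 'X_{1..n}).

Definition monomial_value a m : quat R := \prod_(i < n) a 0 i ^+ m i.

Definition twisted_eval P a g : quat R :=
  \sum_(m <- msupp P) monomial_value a m * g * P@_m.

Definition conj_point g a : 'rV[quat R]_n := map_mx (fun x => g^-1 * x * g) a.

Definition commuting a := forall i j, GRing.comm (a 0 i) (a 0 j).

Lemma slice_evalE P a : slice_eval P a = twisted_eval P a 1.
Proof. by apply: eq_bigr => m _; rewrite mulr1. Qed.

Lemma twisted_evalwE k P a g : (msize P <= k)%N ->
  twisted_eval P a g =
  \sum_(m : 'X_{1..n < k}) monomial_value a m * g * P@_m.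
Proof.
move=> le; rewrite /twisted_eval.
rewrite (big_mksub 'X_{1..n < k}) ?msupp_uniq //=; first last.
  by move=> x /msize_mdeg_lt /leq_trans; apply.
by rewrite big_rmcond //= => m /memN_msupp_eq0 ->; rewrite mulr0.
Qed.

Lemma twisted_evalD P Q a g :
  twisted_eval (P + Q) a g = twisted_eval P a g + twisted_eval Q a g.
Proof.
pose k := maxn (msize (P + Q)) (maxn (msize P) (msize Q)).
rewrite !(@twisted_evalwE k) ?/k ?leq_max ?leqnn ?orbT //.
by rewrite -big_split; apply: eq_bigr => m _; rewrite mcoeffD mulrDr.
Qed.

Lemma twisted_eval0 a g : twisted_eval 0 a g = 0.
Proof. by rewrite /twisted_eval msupp0 big_nil. Qed.

Lemma twisted_eval_sum (T : Type) (s : seq T) (F : T -> {mpoly (quat R)[n]}) a g :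
  twisted_eval (\sum_(i <- s) F i) a g = \sum_(i <- s) twisted_eval (F i) a g.
Proof.
apply: (big_morph (fun P => twisted_eval P a g)); last exact: twisted_eval0.
by move=> P Q; apply: twisted_evalD.
Qed.

Lemma twisted_eval0r P a : twisted_eval P a 0 = 0.
Proof. by apply: big1 => m _; rewrite mulr0 mul0r. Qed.

Lemma twisted_evalDr P a x y :
  twisted_eval P a (x + y) = twisted_eval P a x + twisted_eval P a y.
Proof.
by rewrite -big_split; apply: eq_bigr => m _; rewrite mulrDr mulrDl.
Qed.

Lemma twisted_evalZX c m a g :
  twisted_eval (c *: 'X_[m]) a g = monomial_value a m * g * c.
Proof.
have [->|c0] := eqVneq c 0.
  by rewrite scale0r mulr0 twisted_eval0.
rewrite /twisted_eval (perm_big [:: m]) ?big_seq1; last first.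
  by rewrite msuppMCX.
by rewrite mcoeffZ mcoeffX eqxx mulr1.
Qed.

Lemma monomial_comm a m x : (forall i, GRing.comm x (a 0 i)) ->
  GRing.comm x (monomial_value a m).
Proof. by move=> xa; apply: commr_prod => i _; apply: commrX. Qed.

Lemma monomial_valueD a m1 m2 : commuting a ->
  monomial_value a (m1 + m2) = monomial_value a m1 * monomial_value a m2.
Proof.
move=> ca; rewrite /monomial_value -prodrM_comm; last first.
  by move=> i j _ _; apply: commrX; apply/commr_sym/commrX.
by apply: eq_bigr => i _; rewrite mnmDE exprD.
Qed.

Lemma mulZXZX (c d : quat R) m1 m2 :
  (c *: 'X_[m1]) * (d *: 'X_[m2]) = (c * d) *: 'X_[m1 + m2] :> {mpoly (quat R)[n]}.
Proof.
rewrite -scalerAl -[X in _ *: X](commr_mpolyX m1 (d *: 'X_[m2])).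
by rewrite -scalerAl -mpolyXD scalerA addmC.
Qed.

(** [a^(l+m) g p_l q_m = a^m (a^l g p_l) q_m]. *)
Lemma twisted_evalM P Q a g : commuting a ->
  twisted_eval (P * Q) a g = twisted_eval Q a (twisted_eval P a g).
Proof.
move=> ca; rewrite {1}[P]mpolyE mulr_suml twisted_eval_sum.
rewrite [X in _ = twisted_eval _ _ X]/twisted_eval.
rewrite (big_morph _ (twisted_evalDr Q a) (twisted_eval0r Q a)).
apply: eq_bigr => m1 _; rewrite {1}[Q]mpolyE mulr_sumr twisted_eval_sum.
apply: eq_bigr => m2 _; rewrite mulZXZX twisted_evalZX addmC monomial_valueD //.
by rewrite !mulrA.
Qed.

Lemma twisted_evalC c a g : twisted_eval (mpolyC n c) a g = g * c.
Proof.
have -> : mpolyC n c = c *: 'X_[0] by rewrite mpolyX0 -mul_mpolyC mulr1.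
rewrite twisted_evalZX /monomial_value big1 ?mul1r // => i _.
by rewrite mnm0E.
Qed.

Lemma twisted_eval_linear P a x g : (forall i, GRing.comm x (a 0 i)) ->
  twisted_eval P a (x * g) = x * twisted_eval P a g.
Proof.
move=> xa; rewrite mulr_sumr; apply: eq_bigr => m _.
by rewrite !mulrA (monomial_comm m xa).
Qed.

Lemma monomial_conj g a m : g != 0 ->
  monomial_value (conj_point g a) m = g^-1 * monomial_value a m * g.
Proof.
move=> g0; have gU : g \is a GRing.unit by [].
rewrite /monomial_value.
rewrite (big_morph (fun x => g^-1 * x * g) (op1 := *%R) (id1 := 1)).
- apply: eq_bigr => i _; rewrite mxE; elim: (m i) => [|k IH].
    by rewrite !expr0 mulr1 mulVr.
  by rewrite !exprS IH !mulrA mulrK.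
- by move=> x y; rewrite !mulrA mulrK.
- by rewrite mulr1 mulVr.
Qed.

(** [(g^-1 a g)^l p = g^-1 (a^l g p)]: the values of [P] on the whole orbit of
    [a] are read off from one additive map. *)
Lemma slice_eval_conj P a g : g != 0 ->
  slice_eval P (conj_point g a) = g^-1 * twisted_eval P a g.
Proof.
move=> g0; rewrite mulr_sumr; apply: eq_bigr => m _.
by rewrite -[X in X * _]/(monomial_value _ _) monomial_conj // !mulrA.
Qed.

Lemma slice_eval_conj_eq0 P a g : g != 0 ->
  slice_eval P (conj_point g a) = 0 <-> twisted_eval P a g = 0.
Proof.
move=> g0; rewrite slice_eval_conj //; split=> [E|->]; last by rewrite mulr0.
have gU : g^-1 \is a GRing.unit by apply: quat_inv_neq0.
by apply: (mulrI gU); rewrite E mulr0.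
Qed.

(** * Slices *)

Lemma slice_comm K b x : slice_space K b -> GRing.comm x K ->
  forall i, GRing.comm x (b 0 i).
Proof.
move=> [z _ <-] xK i; rewrite mxE; apply: commrD.
  by apply/commr_sym; apply: quat_realC.
by apply: commrM => //; apply/commr_sym; apply: quat_realC.
Qed.

Lemma slice_commuting K b : slice_space K b -> commuting b.
Proof.
move=> bK i j; apply: (slice_comm bK); apply/commr_sym.
exact: (slice_comm bK).
Qed.

Lemma slice_conj K b g : g != 0 -> slice_space K b ->
  slice_space (g^-1 * K * g) (conj_point g b).
Proof.
move=> g0 [z _ <-]; exists z => //; apply/rowP => i; rewrite !mxE /to_slice.
have gU : g \is a GRing.unit by [].
by rewrite mulrDr mulrDl -(quat_realC _ g^-1) mulrVK // !mulrA quat_realC.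
Qed.

Lemma imag_unit_conj K g : g != 0 -> imag_unit K -> imag_unit (g^-1 * K * g).
Proof.
move=> g0; rewrite /imag_unit /= !expr2 => KK.
have gU : g \is a GRing.unit by [].
by rewrite !mulrA mulrK // -(mulrA _ K K) KK mulrN1 mulNr mulVr.
Qed.

Lemma slices_conj b g : g != 0 ->
  (\bigcup_(K in @imag_unit R) slice_space K) b ->
  (\bigcup_(K in @imag_unit R) slice_space K) (conj_point g b).
Proof.
move=> g0 [K KK bK]; exists (g^-1 * K * g); first exact: imag_unit_conj.
exact: slice_conj.
Qed.

Lemma conj_pointK g a : g != 0 -> conj_point g^-1 (conj_point g a) = a.
Proof.
move=> g0; have gU : g \is a GRing.unit by [].
by apply/rowP => i; rewrite !mxE invrK !mulrA mulrV // mul1r mulrK.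
Qed.

(** * Symmetrization of polynomials *)

Lemma mcoeff_reg_conj P m : (reg_conj P)@_m = quat_conj P@_m.
Proof. exact: mcoeff_map_mpoly. Qed.

Lemma reg_conjK P : reg_conj (reg_conj P) = P.
Proof. by apply/mpolyP => m; rewrite !mcoeff_reg_conj quat_conjK. Qed.

Lemma reg_conjM P Q : reg_conj (P * Q) = reg_conj Q * reg_conj P.
Proof.
apply/mpolyP => m; rewrite mcoeff_reg_conj mcoeffM mcoeffMr raddf_sum.
by apply: eq_bigr => k _; rewrite !mcoeff_reg_conj -quat_conjM.
Qed.

(** [P^s] is fixed by regular conjugation, which reverses products. *)
Lemma mcoeff_reg_sym P m :
  (reg_sym P)@_m = quat_real (q_re (reg_sym P)@_m).
Proof.
apply: quat_conj_real; rewrite -mcoeff_reg_conj /reg_sym reg_conjM.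
by rewrite reg_conjK.
Qed.

(** Both sides have real coefficients, and their real parts agree because the
    real part of a product of two quaternions is symmetric. *)
Lemma reg_symC P : reg_conj P * P = reg_sym P.
Proof.
have := mcoeff_reg_sym (reg_conj P); rewrite /reg_sym reg_conjK => E.
apply/mpolyP => m; rewrite E [RHS]mcoeff_reg_sym; congr quat_real.
rewrite /reg_sym mcoeffM mcoeffMr !raddf_sum; apply: eq_bigr => k _.
exact: quat_reC.
Qed.

Lemma twisted_eval_reg_sym P a g :
  twisted_eval (reg_sym P) a g = slice_eval (reg_sym P) a * g.
Proof.
rewrite mulr_suml; apply: eq_bigr => m _.
by rewrite mcoeff_reg_sym -!mulrA quat_realC.
Qed.

Lemma reg_sym_conj_eq0 P a g : g != 0 -> slice_eval (reg_sym P) a = 0 ->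
  slice_eval (reg_sym P) (conj_point g a) = 0.
Proof.
by move=> g0 E; rewrite slice_eval_conj // twisted_eval_reg_sym E mul0r mulr0.
Qed.

(** If the twisted evaluation of [P^c] is nonzero, its values are in the kernel
    of that of [P], since [P^s = P^c * P].  If it is zero, [P] itself vanishes
    at [b]: by [quat_conj_units], [P(b)] is a real combination of the products
    [twisted_eval P^c b e * e], where [e] is 1, [i], [j] or [k]. *)
Lemma sym_zero_singular P b : commuting b -> slice_eval (reg_sym P) b = 0 ->
  exists2 g : quat R, g != 0 & twisted_eval P b g = 0.
Proof.
move=> cb Ps0.
have [[g gn0]|N] := pselect (exists g, twisted_eval (reg_conj P) b g != 0).
  exists (twisted_eval (reg_conj P) b g) => //.
  by rewrite -twisted_evalM // reg_symC twisted_eval_reg_sym Ps0 mul0r.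
have Pc0 g : twisted_eval (reg_conj P) b g = 0.
  by apply/eqP; apply: contraT => gn0; case: N; exists g.
exists 1; first exact: oner_neq0.
pose d := maxn (msize P) (msize (reg_conj P)).
pose S x := \sum_(m : 'X_{1..n < d}) monomial_value b m * x * quat_conj P@_m.
have S0 x : S x = 0.
  transitivity (twisted_eval (reg_conj P) b x); last exact: Pc0.
  rewrite (@twisted_evalwE d) ?leq_maxr //.
  by apply: eq_bigr => m _; rewrite mcoeff_reg_conj.
rewrite (@twisted_evalwE d) ?leq_maxl //.
transitivity (- (quat_real 2^-1 *
    (S 1 * 1 + S (Quat 0 1 0 0) * Quat 0 1 0 0
     + S (Quat 0 0 1 0) * Quat 0 0 1 0 + S (Quat 0 0 0 1) * Quat 0 0 0 1))).
  rewrite /S !mulr_suml -!big_split /= mulr_sumr -sumrN.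
  apply: eq_bigr => m _.
  rewrite {1}[P@_ m]quat_conj_units !mulr1 mulrN mulrA -quat_realC -mulrA.
  by rewrite !mulrDr !mulrA.
by rewrite !S0 !mul0r !addr0 mulr0 oppr0.
Qed.

(** A left ideal of endomorphisms of a plane whose members are all singular has
    a common kernel vector; here composition on the left is multiplication of
    polynomials on the right. *)
Lemma singular_common_kernel (I : set {mpoly (quat R)[n]}) K b :
  right_ideal I -> imag_unit K -> slice_space K b ->
  (forall P, I P -> exists2 g : quat R, g != 0 & twisted_eval P b g = 0) ->
  exists2 g : quat R, g != 0 & forall P, I P -> twisted_eval P b g = 0.
Proof.
move=> [_ ID IM] KK bK sing; have cb := slice_commuting bK.
have lin P x g : GRing.comm x K ->
    twisted_eval P b (x * g) = x * twisted_eval P b g.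
  by move=> xK; apply: twisted_eval_linear; apply: slice_comm bK xK.
have [all0|] := pselect (forall P, I P -> forall g, twisted_eval P b g = 0).
  by exists 1; [exact: oner_neq0 | move=> P IP; exact: all0].
move=> /existsNP[P /not_implyP[IP /existsNP[h Ph]]].
have [g g0 Pg] := sing _ IP.
exists g => // P' IP'; apply/eqP; apply: contraT => vn0.
set v := twisted_eval P' b g in vn0.
have gU : g \is a GRing.unit by [].
have [J J0 KJ] := anticommuting_exists KK.
have basis x : exists al be,
    [/\ GRing.comm al K, GRing.comm be K & x = al * g + be * (J * g)].
  have [al [be [alK beK E]]] := centralizer_basis (x * g^-1) KK J0 KJ.
  exists al, be; split=> //.
  by rewrite mulrA -mulrDl -E mulrVK.
have u0 : twisted_eval P b (J * g) != 0.
  apply/eqP => u0; case: Ph; have [al [be [alK beK ->]]] := basis h.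
  by rewrite twisted_evalDr (lin _ al) // (lin _ be) // Pg u0 !mulr0 addr0.
set u := twisted_eval P b (J * g) in u0.
have uU : u \is a GRing.unit by [].
(* The constant is chosen so that [T], whose map sends [g] to [v], sends [J g]
   to [J v]; by linearity this map is [f |-> f g^-1 v], which is bijective. *)
pose c := u^-1 * (J * v - twisted_eval P' b (J * g)).
pose T := P * mpolyC n c + P'.
have [f f0] : exists2 f : quat R, f != 0 & twisted_eval T b f = 0.
  by apply: sing; apply: ID => //; apply: IM.
have Tg : twisted_eval T b g = v.
  by rewrite twisted_evalD twisted_evalM // Pg twisted_evalC mul0r add0r.
have TJg : twisted_eval T b (J * g) = J * v.
  by rewrite twisted_evalD twisted_evalM // twisted_evalC mulrA mulrV // mul1r subrK.
have [al [be [alK beK E]]] := basis f.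
rewrite {1}E twisted_evalDr (lin _ al) // (lin _ be) // Tg TJg mulrA -mulrDl => E0.
have fE : al + be * J = f * g^-1 by rewrite E mulrA -mulrDl mulrK.
have : f * g^-1 * v != 0.
  by apply: quat_mul_neq0 => //; apply: quat_mul_neq0 => //; apply: quat_inv_neq0.
by rewrite -fE E0 eqxx.
Qed.

(** * Symmetrized ideals *)

(** Vanishing at a point with commuting components is stable under right
    multiplication, so the generators alone decide. *)
Lemma zero_set_cE (A : set {mpoly (quat R)[n]}) b :
  zero_set_c (right_ideal_gen A) b <->
  (\bigcup_(K in @imag_unit R) slice_space K) b /\
  (forall P, A P -> slice_eval P b = 0).
Proof.
split=> [[b0 bS]|[bS A0]]; first by split=> // P AP; apply: b0 => J _; apply.
split=> // P genP; apply: (genP [set Q | slice_eval Q b = 0]); last exact: A0.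
have cb : commuting b by case: bS => K _; apply: slice_commuting.
split=> /=.
- by rewrite slice_evalE twisted_eval0.
- by move=> Q Q'; rewrite !slice_evalE twisted_evalD => -> ->; rewrite addr0.
- by move=> Q Q'; rewrite !slice_evalE twisted_evalM // => ->; rewrite twisted_eval0r.
Qed.

Lemma zero_set_c_sym_idealE (I : set {mpoly (quat R)[n]}) b :
  zero_set_c (sym_ideal I) b <->
  (\bigcup_(K in @imag_unit R) slice_space K) b /\
  (forall P, I P -> slice_eval (reg_sym P) b = 0).
Proof.
apply: (iff_trans (zero_set_cE _ b)); split=> -[bS H]; split=> //.
  by move=> P IP; apply: H; exists P.
by move=> _ [P IP <-]; apply: H.
Qed.

Lemma symmetrization_zero_set_c (I : set {mpoly (quat R)[n]}) :
  right_ideal I -> symmetrization (zero_set_c I) = zero_set_c (sym_ideal I).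
Proof.
move=> hI; apply/seteqP; split=> b.
  move=> [a [a0 aS] [g g0 <-]]; apply/zero_set_c_sym_idealE.
  split; first exact: slices_conj.
  move=> P IP; apply: reg_sym_conj_eq0 => //.
  case: aS => K _ /slice_commuting ca.
  rewrite slice_evalE twisted_evalM // -slice_evalE a0 //.
  exact: twisted_eval0r.
move=> /zero_set_c_sym_idealE[bS Ps0]; have [K KK bK] := bS.
have [P IP|g g0 Ig] := singular_common_kernel hI KK bK.
  by apply: sym_zero_singular (slice_commuting bK) _; apply: Ps0.
exists (conj_point g b).
  split; last exact: slices_conj.
  by move=> P IP; apply/slice_eval_conj_eq0; last exact: Ig.
exists g^-1; first exact: quat_inv_neq0.
exact: conj_pointK.
Qed.

(** * Slice algebraicity *)

(** The restriction to a slice of a polynomial with real coefficients. *)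
Definition real_part_poly P : {mpoly R[i][n]} :=
  \sum_(m <- msupp P) (q_re P@_m)%:C%C *: 'X_[m].

Lemma to_sliceD K : {morph to_slice K : x y / x + y}.
Proof.
by move=> [a b] [c d]; case: K => *; congr Quat => /=; ring.
Qed.

Lemma to_sliceM K : imag_unit K -> {morph to_slice K : x y / x * y}.
Proof.
move=> KK [a b] [c d]; rewrite /to_slice /=.
rewrite mulrDl !mulrDr -[_ * K * (_ * K)]mulrA [K * _]mulrA -(quat_realC d K).
rewrite -[_ * K * K]mulrA -expr2 KK.
by case: K {KK} => *; congr Quat => /=; ring.
Qed.

Lemma to_slice_real K (t : R) : to_slice K t%:C%C = quat_real t.
Proof. by case: K => *; congr Quat => /=; ring. Qed.

Lemma to_slice_eq0 K (x : R[i]) : imag_unit K -> to_slice K x = 0 -> x = 0.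
Proof.
move=> KK x0; apply/eqP; apply: contraT => xn0.
have /eqP := congr1 (to_slice K) (divff xn0).
by rewrite to_sliceM // x0 mul0r -[1]/(1%:C%C) to_slice_real eq_sym oner_eq0.
Qed.

Lemma slice_eval_real K P (z : 'rV[R[i]]_n) : imag_unit K ->
  (forall m, P@_m = quat_real (q_re P@_m)) ->
  slice_eval P (map_mx (to_slice K) z) = to_slice K (real_part_poly P).@[z 0].
Proof.
move=> KK Pr.
have K0 : to_slice K 0 = 0 by rewrite -[0]/(0%:C%C) to_slice_real.
have K1 : to_slice K 1 = 1 by rewrite -[1]/(1%:C%C) to_slice_real.
rewrite /real_part_poly raddf_sum (big_morph _ (to_sliceD K) K0).
apply: eq_bigr => m _; rewrite /= mevalZ mevalX to_sliceM // to_slice_real.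
rewrite -Pr {2}Pr quat_realC -Pr; congr (_ * _).
rewrite (big_morph _ (to_sliceM KK) K1); apply: eq_bigr => i _; rewrite mxE.
by elim: (m i) => [|k IH]; rewrite ?expr0 // !exprS to_sliceM // IH.
Qed.

Lemma slice_algebraic_zero_set_c_sym_ideal (I : set {mpoly (quat R)[n]}) :
  slice_algebraic (zero_set_c (sym_ideal I)).
Proof.
move=> K KK; exists [set real_part_poly (reg_sym P) | P in I].
apply/seteqP; split=> b.
  move=> [/zero_set_c_sym_idealE[_ Ps0] [z _ zb]]; exists z => //.
  move=> _ [P IP <-]; apply: (to_slice_eq0 KK).
  by rewrite -slice_eval_real ?zb ?Ps0 //; apply: mcoeff_reg_sym.
move=> [z z0 zb]; have bK : slice_space K b by exists z.
split=> //; apply/zero_set_c_sym_idealE; split; first by exists K.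
move=> P IP; rewrite -zb slice_eval_real //; last exact: mcoeff_reg_sym.
by rewrite z0; [rewrite -[0]/(0%:C%C) to_slice_real | exists P].
Qed.

End TwistedEvaluation.

Theorem theorem3p6 (R : realType) (n : nat) (I : set {mpoly (quat R)[n]})
    (hI : right_ideal I) :
  slice_algebraic (symmetrization (zero_set_c I)) /\
  symmetrization (zero_set_c I) = zero_set_c (sym_ideal I).
Proof.
have E := symmetrization_zero_set_c hI; split=> //.
by rewrite E; apply: slice_algebraic_zero_set_c_sym_ideal.
Qed.
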